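(* Let $\nu,\rho,\alpha>0$ with $\frac{3d}{2}\rho^2<\alpha$. For all $(\mathbf{u}_h,p_h),(\mathbf{w}_h,z_h)\in\mathbf{X}_h\times Q_h$, $$\|G(\mathbf{u}_h,p_h)-G(\mathbf{w}_h,z_h)\|_{\mathcal{H}_h}\le C_L\,\|(\mathbf{u}_h,p_h)-(\mathbf{w}_h,z_h)\|_{\mathcal{H}_h},$$ where $$C_L=\sqrt2\,\max\left\{\sqrt{\frac2K},\ \frac1{\sqrt K}\left(1+\rho\mathcal{M}\left(\|(\mathbf{w}_h,z_h)\|_{\mathcal{H}_h}+\sqrt{\frac{\rho}{\nu}}\,\|\mathbf{f}\|_{-1}\right)\right)\right\},\qquad K=\min\left\{\frac14,\ \frac12-\frac{3d\rho^2}{4\alpha}\right\}.$$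
   Context: Let $d\in\{2,3\}$ and let $\Omega\subset\mathbb{R}^d$ be a bounded domain with Lipschitz boundary. $(\cdot,\cdot)$ and $\|\cdot\|$ denote the $L^2(\Omega)$ inner product and norm (for scalar, vector or matrix fields). Put $\mathbf{X}=[H_0^1(\Omega)]^d$ and $Q=L^2_0(\Omega)=\{q\in L^2(\Omega):\int_\Omega q=0\}$. Let $\mathbf{f}\in \mathbf{X}'$ (the dual of $\mathbf{X}$), write $(\mathbf{f},\mathbf{v})$ for the duality pairing, and let $\|\mathbf{f}\|_{-1}=\sup_{0\neq\mathbf{v}\in\mathbf{X}}|(\mathbf{f},\mathbf{v})|/\|\nabla\mathbf{v}\|$. Let $\mathbf{X}_h\subset\mathbf{X}$ and $Q_h\subset Q$ be finite-dimensional (finite element) subspaces. Skew-symmetric trilinear form: $b^*(\mathbf{u},\mathbf{v},\mathbf{w})=\tfrac12((\mathbf{u}\cdot\nabla)\mathbf{v},\mathbf{w})-\tfrac12((\mathbf{u}\cdot\nabla)\mathbf{w},\mathbf{v})$ for $\mathbf{u},\mathbf{v},\mathbf{w}\in\mathbf{X}$. The constant $\mathcal{M}=\sup_{\mathbf{u},\mathbf{v},\mathbf{w}\in\mathbf{X}\setminus\{0\}}\frac{|(\mathbf{u}\cdot\nabla\mathbf{v},\mathbf{w})|}{\|\nabla\mathbf{u}\|\|\nabla\mathbf{v}\|\|\nabla\mathbf{w}\|}$ is finite, and $|b^*(\mathbf{u},\mathbf{v},\mathbf{w})|\le\mathcal{M}\|\nabla\mathbf{u}\|\|\nabla\mathbf{v}\|\|\nabla\mathbf{w}\|$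 is the standard (known) continuity bound. Product space and norm: $\mathcal{H}_h=\mathbf{X}_h\times Q_h$, $\|(\mathbf{v}_h,q_h)\|_{\mathcal{H}_h}=(\|\nabla\mathbf{v}_h\|^2+\alpha\|q_h\|^2)^{1/2}$. Operator $G:\mathcal{H}_h\to\mathcal{H}_h$: for $(\mathbf{u}_h,p_h)\in\mathcal{H}_h$, $G(\mathbf{u}_h,p_h)=(\mathbf{U}_h,P_h)$, with $\mathbf{U}_h=G_1(\mathbf{u}_h,p_h)$ and $P_h=G_2(\mathbf{u}_h,p_h)$, is the unique pair in $\mathcal{H}_h$ such that, for all $(\mathbf{v}_h,q_h)\in\mathbf{X}_h\times Q_h$, $$\tfrac1\rho(\nabla(\mathbf{U}_h-\mathbf{u}_h),\nabla\mathbf{v}_h)+\nu(\nabla\mathbf{U}_h,\nabla\mathbf{v}_h)+b^*(\mathbf{u}_h,\mathbf{U}_h,\mathbf{v}_h)+\tfrac{\rho}{\alpha}(\nabla\cdot\mathbf{U}_h,\nabla\cdot\mathbf{v}_h)-(p_h,\nabla\cdot\mathbf{v}_h)=(\mathbf{f},\mathbf{v}_h),$$ $$\alpha(P_h-p_h,q_h)+\rho(\nabla\cdot\mathbf{U}_h,q_h)=0.$$ *)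

(* Defs.v *)
From HB Require Import structures.
From mathcomp Require Import all_boot all_order all_algebra.
From mathcomp Require Import all_classical all_reals all_analysis.

Set Implicit Arguments.
Unset Strict Implicit.
Unset Printing Implicit Defensive.

Import Order.TTheory GRing.Theory Num.Theory.
Import numFieldNormedType.Exports.

Local Open Scope classical_set_scope.
Local Open Scope ring_scope.

(** * Lebesgue measure on R^d *)

Definition measure_rV_display : measure_display -> measure_display.
Proof. exact. Qed.

(* The product sigma-algebra, i.e. the one generated by the coordinates. *)
Section measurable_rV.
Context {disp : measure_display} {T : measurableType disp} (n : nat).

Let coors : 'I_n -> 'rV[T]_n -> T := fun i x => x ord0 i.

Let rV_set0 : g_sigma_preimage coors set0.
Proof. exact: sigma_algebra0. Qed.

Let rV_setC A : g_sigma_preimage coors A -> g_sigma_preimage coors (~` A).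
Proof. exact: sigma_algebraC. Qed.

Let rV_bigcup (F : _^nat) : (forall i, g_sigma_preimage coors (F i)) ->
  g_sigma_preimage coors (\bigcup_i (F i)).
Proof. exact: sigma_algebra_bigcup. Qed.

HB.instance Definition _ := @isMeasurable.Build (measure_rV_display disp)
  'rV[T]_n (g_sigma_preimage coors) rV_set0 rV_setC rV_bigcup.

End measurable_rV.

Section lebesgue_rV.
Variable R : realType.

Definition rV_cons (n : nat) (p : 'rV[R]_n * R) : 'rV[R]_n.+1 :=
  \row_i oapp (p.1 ord0) p.2 (unlift ord0 i).

Lemma measurable_coord (n : nat) (i : 'I_n) :
  measurable_fun [set: 'rV[R]_n] (fun x : 'rV[R]_n => x ord0 i).
Proof.
move=> _ Y mY; rewrite setTI; apply: sub_sigma_algebra => /=.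
rewrite -bigcup_seq/=; exists i => /=; first by rewrite mem_index_enum.
by exists Y => //; rewrite setTI.
Qed.

Lemma measurable_rV_cons (n : nat) :
  measurable_fun [set: 'rV[R]_n * R] (@rV_cons n).
Proof.
have mi (i : 'I_n.+1) :
    measurable_fun setT (fun p : 'rV[R]_n * R => rV_cons p ord0 i).
  have [j ->|->] := unliftP ord0 i.
    rewrite (_ : (fun _ => _) = (fun x : 'rV[R]_n => x ord0 j) \o fst).
      by apply: measurableT_comp => //; exact: measurable_coord.
    by apply/funext => p; rewrite mxE liftK.
  rewrite (_ : (fun _ => _) = snd) //.
  by apply/funext => p; rewrite mxE unlift_none.
move=> _ Y mY.
have : preimage_set_system setT (@rV_cons n) measurable `<=` measurable.
  rewrite [X in preimage_set_system _ _ X](_ : _ =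
    g_sigma_preimage (fun i (x : 'rV[R]_n.+1) => x ord0 i)) //.
  rewrite -g_sigma_preimage_comp.
  apply: smallest_sub; first exact: sigma_algebra_measurable.
  rewrite -bigcup_mkord_ord; apply: bigcup_sub => i Ii.
  by move=> A [B mB <-]; exact: mi.
by apply; exists Y.
Qed.

(* Lebesgue measure on R^(n+1) is the product of those on R^n and on R. *)
Fixpoint leb (n : nat) : {measure set 'rV[R]_n -> \bar R} :=
  match n with
  | 0 => dirac (0 : 'rV[R]_0)
  | n'.+1 => measure_function_pushforward__canonical__measure_function_Measure
      (leb n' \x lebesgue_measure)%E (@measurable_rV_cons n')
  end.

End lebesgue_rV.

(** * Domains *)

Section domains.
Variables (R : realType) (d : nat).
Local Notation point := 'rV[R]_d.

Definition dotr (x y : point) : R := \sum_(i < d) x ord0 i * y ord0 i.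

Definition bounded_domain (Om : set point) : Prop :=
  [/\ Om !=set0, open Om, connected Om & bounded_set Om].

(* Near every boundary point x, in coordinates rotated so that the unit vector
   e is the vertical direction and centred at x, Om is the open region strictly
   above the graph of a Lipschitz function gam of the horizontal variables
   (the component of z - x orthogonal to e). *)
Definition lipschitz_boundary (Om : set point) : Prop :=
  forall x, (closure Om `\` interior Om) x ->
  exists (e : point) (gam : point -> R) (k : R),
    [/\ dotr e e = 1,
        k.-lipschitz_setT gam &
        \forall z \near x,
          let t := dotr (z - x) e in
          Om z <-> gam ((z - x) - t *: e) < t].

End domains.

(** * Function spaces *)

(* Functions are representatives of classes modulo a.e. equality on Om. *)

Section scalar_spaces.
Variables (R : realType) (d : nat) (Om : set 'rV[R]_d).
Local Notation point := 'rV[R]_d.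
Local Notation mu := (@leb R d).

Definition L2 (u : point -> R) : Prop :=
  measurable_fun Om u /\ mu.-integrable Om (fun x => (u x ^+ 2)%:E).

Definition ip (u v : point -> R) : R := \int[mu]_(x in Om) (u x * v x).

Definition L2norm (u : point -> R) : R := Num.sqrt (ip u u).

Definition L20 (q : point -> R) : Prop :=
  L2 q /\ \int[mu]_(x in Om) (q x) = 0.

Definition partial (i : 'I_d) (u : point -> R) : point -> R :=
  fun x => 'D_(delta_mx ord0 i) u x.

Definition smooth (u : point -> R) : Prop :=
  forall s : seq 'I_d, let us := foldr partial u s in
    continuous us /\ forall i x, derivable us x (delta_mx ord0 i).

Definition test_function (phi : point -> R) : Prop :=
  let supp := closure [set x | phi x != 0] in
  [/\ smooth phi, compact supp & supp `<=` Om].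

Definition weak_gradient (u : point -> R) (g : 'I_d -> point -> R) : Prop :=
  forall phi i, test_function phi -> ip u (partial i phi) = - ip (g i) phi.

(* An element of H^1(Om) is a function together with its weak gradient, which
   is determined a.e. by the function. *)
Definition H1 (u : point -> R) (g : 'I_d -> point -> R) : Prop :=
  [/\ L2 u, forall i, L2 (g i) & weak_gradient u g].

Definition H1norm (u : point -> R) (g : 'I_d -> point -> R) : R :=
  Num.sqrt (L2norm u ^+ 2 + \sum_(i < d) L2norm (g i) ^+ 2).

(* the closure of the test functions in H^1(Om) *)
Definition H10 (u : point -> R) (g : 'I_d -> point -> R) : Prop :=
  H1 u g /\
  forall eps : R, 0 < eps -> exists2 phi, test_function phi &
    H1norm (u \- phi) (fun i => g i \- partial i phi) < eps.

End scalar_spaces.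

(* A vector field v.1 together with its weak Jacobian matrix field:
   v.2 x i j is the weak derivative of the i-th component in direction j. *)
Notation vfield R d := (('rV[R]_d -> 'rV[R]_d) * ('rV[R]_d -> 'M[R]_d))%type.

Section vector_spaces.
Variables (R : realType) (d : nat) (Om : set 'rV[R]_d).
Local Notation point := 'rV[R]_d.
Local Notation mu := (@leb R d).
Implicit Types u v w : vfield R d.

(* [H^1_0(Om)]^d *)
Definition X : set (vfield R d) := [set v : vfield R d |
  forall i : 'I_d, H10 Om (fun x => v.1 x ord0 i) (fun j x => v.2 x i j)].

Definition div v : point -> R := fun x => \tr (v.2 x).

Definition grad_ip v w : R :=
  \int[mu]_(x in Om) (\sum_(i < d) \sum_(j < d) v.2 x i j * w.2 x i j).

Definition grad_norm v : R := Num.sqrt (grad_ip v v).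

(* ((u . grad) v, w), as an extended real: it is infinite (in absolute value)
   when the integrand is measurable but not integrable. *)
Definition convection u v w : \bar R :=
  (\int[mu]_(x in Om)
    (\sum_(i < d) \sum_(j < d) u.1 x ord0 j * v.2 x i j * w.1 x ord0 i)%:E)%E.

Definition bstar u v w : R :=
  2^-1 * fine (convection u v w) - 2^-1 * fine (convection u w v).

(* The elements of X that are nonzero (modulo a.e. equality) are those whose
   gradient has a nonzero norm, by the Poincare inequality. *)
Definition Xnz : set (vfield R d) := [set v | X v /\ grad_norm v != 0].

Definition Msup : \bar R := ereal_sup [set m | exists u v w,
  [/\ Xnz u, Xnz v, Xnz w &
      m = (`| convection u v w | *
           ((grad_norm u * grad_norm v * grad_norm w)^-1)%:E)%E]].

Definition Mconst : R := fine Msup.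

(* the dual of X, for the norm v |-> || grad v || on X *)
Definition Xdual (f : vfield R d -> R) : Prop :=
  (forall (a : R) u v, X u -> X v -> f (a *: u + v) = a * f u + f v) /\
  exists C : R, forall v, X v -> `|f v| <= C * grad_norm v.

Definition dual_norm (f : vfield R d -> R) : R :=
  sup [set `|f v| / grad_norm v | v in Xnz].

End vector_spaces.

(* For spaces of representatives, this is a subspace spanned by representatives
   of a basis (or of any finite generating family) of the space of classes. *)
Definition findim_subspace (R : realType) (V : lmodType R) (S : set V) : Prop :=
  exists (n : nat) (b : 'I_n -> V),
    S = [set \sum_(i < n) c i *: b i | c in [set: 'I_n -> R]].

(** * The iteration operator G *)

Section operator.
Variables (R : realType) (d : nat) (Om : set 'rV[R]_d).
Local Notation H := (vfield R d * ('rV[R]_d -> R))%type.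
Variables (Xh : set (vfield R d)) (Qh : set ('rV[R]_d -> R)).
Variables (nu rho alpha : R) (f : vfield R d -> R).

Definition Hh : set H := Xh `*` Qh.

Definition Hnorm (vq : H) : R :=
  Num.sqrt (grad_norm Om vq.1 ^+ 2 + alpha * L2norm Om vq.2 ^+ 2).

Definition G_equations (up UP : H) : Prop :=
  let: (u, p) := up in let: (U, P) := UP in
  forall v q, Xh v -> Qh q ->
    rho^-1 * grad_ip Om (U - u) v + nu * grad_ip Om U v + bstar Om u U v
      + rho / alpha * ip Om (div U) (div v) - ip Om p (div v) = f v
    /\ alpha * ip Om (P - p) q + rho * ip Om (div U) q = 0.

(* G maps (u, p) to a solution in Hh of its defining equations. Uniqueness of
   that solution (modulo a.e. equality) need not be required. *)
Definition is_G (G : H -> H) : Prop :=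
  forall up, Hh up -> Hh (G up) /\ G_equations up (G up).

Definition Kconst : R :=
  Num.min (1 / 4) (1 / 2 - 3 * d%:R * rho ^+ 2 / (4 * alpha)).

Definition CL (wz : H) : R :=
  Num.sqrt 2 *
  Num.max (Num.sqrt (2 / Kconst))
    (1 / Num.sqrt Kconst *
      (1 + rho * Mconst Om *
        (Hnorm wz + Num.sqrt (rho / nu) * dual_norm Om f))).

End operator.

(* Main.v *)
(* Subtracting the equations for (u, p) and (w, z), and testing with
   (U - W, P - Z), kills the term b*(u, U - W, U - W); the divergence terms are
   absorbed by Young's inequality.  Writing N and n for the norms of the output
   and input differences, this leaves
     N^2 <= n^2 + 2 B n N  with  B = rho M |grad W|,  hence  N <= (1 + 2 B) n.
   Testing the equation for (w, z) with W bounds |grad W|.  Since K <= 1/4, the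
   second entry of the maximum in C_L is at least 2 (1 + B). *)
Require Import Defs.
From mathcomp Require Import all_boot all_order all_algebra.
From mathcomp Require Import all_classical all_reals all_analysis.
From mathcomp Require Import measurable_realfun ring lra.
Set Implicit Arguments.
Unset Strict Implicit.
Unset Printing Implicit Defensive.
Import numFieldNormedType.Exports.
Import Order.TTheory GRing.Theory Num.Theory.
Local Open Scope classical_set_scope.
Local Open Scope ring_scope.

(** * Measurability of open sets and a criterion for integrability *)

(** The sigma-algebra on row vectors is generated by the coordinates, not by the open sets. An open
    set is the union of the boxes with rational centre and half-width [1/(n+1)] that it contains,
    and there are only countably many such boxes. *)
Lemma open_measurable_rV (R : realType) (d : nat) (Om : set 'rV[R]_d) :
  open Om -> measurable Om.
Proof.
move=> oOm.
pose box (qn : 'rV[rat]_d * nat) : set 'rV[R]_d :=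
  [set y | forall i, `|y ord0 i - ratr (qn.1 ord0 i)| < (qn.2.+1%:R)^-1].
pose D := [set qn | box qn `<=` Om].
have -> : Om = \bigcup_(qn in D) box qn.
  apply/seteqP; split=> [x Omx|x [qn qnD]]; last exact: qnD.
  have /nbhs_ballP[e /= e0 xe] : nbhs x Om by rewrite nbhsE; exists Om.
  have e20 : 0 < e / 2 by rewrite divr_gt0.
  have [n _ /(_ n (leqnn n)) /= ne] := near_infty_natSinv_lt (PosNum e20).
  have n0 : (0 : R) < n.+1%:R^-1 by rewrite invr_gt0.
  have rx (i : 'I_d) : exists q : rat, `|x ord0 i - ratr q| < n.+1%:R^-1.
    move: (n.+1%:R^-1) n0 => c c0.
    have [|q] := @rat_in_itvoo _ (x ord0 i - c) (x ord0 i + c); first lra.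
    rewrite in_itv /= => /andP[q1 q2]; exists q.
    by rewrite ltr_norml; apply/andP; split; lra.
  have [q qP] := choice rx.
  exists (\row_i q i, n) => /=; last by move=> i /=; rewrite mxE.
  move=> y /= yP; apply: xe; split=> // i j /=.
  rewrite (ord1 i) -ball_normE /= /ball_.
  have /= := yP j; have := qP j; rewrite mxE distrC => h1 h2.
  apply: (@le_lt_trans _ _ (`|x ord0 j - ratr (q j)| + `|y ord0 j - ratr (q j)|)).
    by rewrite [`|y _ _ - _|]distrC (le_trans _ (ler_normD _ _)) // subrKA.
  by move: h1 h2 ne; rewrite [`|ratr _ - _|]distrC /=; move: (n.+1%:R^-1) => c; lra.
rewrite bigcup_mkcond; apply: countable_bigcupT_measurable => // qn.
case: ifP => // _.
rewrite (_ : box qn = \bigcap_(i in [set: 'I_d]) ((fun x : 'rV[R]_d => x ord0 i) @^-1`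
   (ball (ratr (qn.1 ord0 i) : R) (qn.2.+1%:R^-1)))).
  apply: fin_bigcap_measurable => // i _; rewrite -[X in measurable X]setTI.
  by apply: measurable_coord => //; exact: measurable_ball.
by apply/seteqP; split=> [x xb i _|x xb i]; have := xb i; rewrite -ball_normE /= distrC => //; exact.
Qed.

(** The integral is the difference of the integrals of the positive and negative parts. As
    [+oo - +oo] is [-oo] and not a finite default, a finite value forces both parts to be finite. *)
Lemma fin_num_integrable d (T : measurableType d) (R : realType)
    (mu : {measure set T -> \bar R}) (D : set T) (mD : measurable D)
    (f : T -> \bar R) :
  measurable_fun D f -> (\int[mu]_(x in D) f x)%E \is a fin_num ->
  mu.-integrable D f.
Proof.
move=> mf; rewrite integralE fin_numB => /andP[fp fn].
apply/integrableP; split=> //.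
under eq_integral => x _ do rewrite [`|f x|%E](congr1 (@^~ x) (fune_abse f)).
rewrite ge0_integralD //.
- rewrite -ge0_fin_numE; first by rewrite fin_numD fp.
  by apply: adde_ge0; apply: integral_ge0.
- exact: measurable_funepos.
- exact: measurable_funeneg.
Qed.

(** * Bilinearity and positivity of the $L^2$ and gradient products *)

Section L2_pairings.
Variables (R : realType) (d : nat) (Om : set 'rV[R]_d).
Hypothesis mOm : measurable Om.
Local Notation point := 'rV[R]_d.
Local Notation mu := (@leb R d).
Local Notation intg F := (mu.-integrable Om (EFin \o F)).

Lemma integrable_lin (a : R) (u v : point -> R) :
  intg u -> intg v -> intg (fun x => a * u x + v x).
Proof.
move=> iu iv; rewrite (_ : _ \o _ = (fun x => a%:E * (EFin \o u) x)%E \+ (EFin \o v))%E.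
  by apply: integrableD => //; exact: integrableZl.
by apply/funext => x /=; rewrite EFinD EFinM.
Qed.

Lemma Rintegral_lin (a : R) (u v : point -> R) : intg u -> intg v ->
  \int[mu]_(x in Om) (a * u x + v x) =
  a * \int[mu]_(x in Om) u x + \int[mu]_(x in Om) v x.
Proof.
move=> iu iv; rewrite RintegralD// ?RintegralZl//.
rewrite (_ : _ \o _ = (fun x => a%:E * (EFin \o u) x)%E).
  exact: integrableZl.
by apply/funext => x /=; rewrite EFinM.
Qed.

Lemma L2_mul_integrable (u v : point -> R) :
  L2 Om u -> L2 Om v -> intg (fun x => u x * v x).
Proof.
move=> [mu_ iu] [mv iv].
(* Domination by $u^2+v^2$; the factor 1 gives it the shape handled by [integrable_lin]. *)
apply: (@le_integrable _ _ _ _ _ mOm _ (EFin \o (fun x => 1 * (u x ^+ 2) + (v x ^+ 2)))).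
- by apply/measurable_EFinP; exact: measurable_funM.
- move=> x _; rewrite !abse_EFin lee_fin /= mul1r.
  rewrite [leRHS]ger0_norm ?addr_ge0 ?sqr_ge0 // ler_norml.
  have h1 := sqr_ge0 (u x + v x); have h2 := sqr_ge0 (u x - v x).
  by apply/andP; split; nra.
- exact: integrable_lin.
Qed.

Lemma L2_lin (a : R) (u v : point -> R) :
  L2 Om u -> L2 Om v -> L2 Om (fun x => a * u x + v x).
Proof.
move=> lu lv; case: (lu) (lv) => mu_ iu [mv iv]; split.
  by apply: measurable_funD => //; apply: measurable_funM.
(* The expanded square is nested so that [integrable_lin] applies twice. *)
rewrite (_ : (fun _ => _) =
    EFin \o (fun x => a * (a * u x ^+ 2 + 2 * (u x * v x)) + v x ^+ 2)).
  do 2!apply: integrable_lin => //.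
  rewrite (_ : _ \o _ = EFin \o (fun x => 1 * (u x * v x) + u x * v x)).
    by apply: integrable_lin; exact: L2_mul_integrable.
  by apply/funext => x /=; congr EFin; ring.
by apply/funext => x /=; congr EFin; ring.
Qed.

Lemma L2_sum (I : Type) (s : seq I) (u : I -> point -> R) :
  (forall i, L2 Om (u i)) -> L2 Om (fun x => \sum_(i <- s) u i x).
Proof.
move=> lu; elim: s => [|i s ih].
  rewrite (_ : (fun _ => _) = cst 0); last by apply/funext => x; rewrite big_nil.
  split; first exact: measurable_cst.
  rewrite (_ : (fun _ => _) = cst 0%E) //; first exact: integrable0.
  by apply/funext => x /=; rewrite expr0n.
rewrite (_ : (fun _ => _) = (fun x => 1 * u i x + \sum_(i <- s) u i x)).
  exact: L2_lin.
by apply/funext => x; rewrite big_cons mul1r.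
Qed.

Lemma ipC (u v : point -> R) : ip Om u v = ip Om v u.
Proof. by apply: eq_Rintegral => x _; rewrite mulrC. Qed.

Lemma ip_ge0 (u : point -> R) : 0 <= ip Om u u.
Proof. by apply: Rintegral_ge0 => x _; rewrite -expr2 sqr_ge0. Qed.

Lemma ip_lin (a : R) (u v w : point -> R) : L2 Om u -> L2 Om v -> L2 Om w ->
  ip Om (fun x => a * u x + v x) w = a * ip Om u w + ip Om v w.
Proof.
move=> lu lv lw; rewrite /ip -Rintegral_lin; try exact: L2_mul_integrable.
by apply: eq_Rintegral => x _; ring.
Qed.

Lemma ipBl (u v w : point -> R) : L2 Om u -> L2 Om v -> L2 Om w ->
  ip Om (u - v) w = ip Om u w - ip Om v w.
Proof.
move=> lu lv lw; rewrite (_ : u - v = (fun x => -1 * v x + u x)).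
  by rewrite ip_lin //; ring.
by apply/funext => x; rewrite mulN1r addrC.
Qed.

Lemma L2B (u v : point -> R) : L2 Om u -> L2 Om v -> L2 Om (u - v).
Proof.
move=> lu lv; rewrite (_ : u - v = (fun x => -1 * v x + u x)); first exact: L2_lin.
by apply/funext => x; rewrite mulN1r addrC.
Qed.

Lemma ip_sqrB (u v : point -> R) : L2 Om u -> L2 Om v ->
  ip Om (u - v) (u - v) = ip Om u u - 2 * ip Om v u + ip Om v v.
Proof.
move=> lu lv; rewrite ipBl //; last exact: L2B.
rewrite [ip Om u (_ - _)]ipC [ip Om v (_ - _)]ipC !ipBl // [ip Om u v]ipC; ring.
Qed.

(** This is the expansion of $\|au+v\|^2$. The weight [a] stays free: the a priori bound takes
    $-2\rho/\alpha$ and the energy estimate takes $\rho/\alpha$. *)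
Lemma ip_young (a : R) (u v : point -> R) : L2 Om u -> L2 Om v ->
  0 <= a ^+ 2 * ip Om u u + 2 * a * ip Om u v + ip Om v v.
Proof.
move=> lu lv; have := ip_ge0 (fun x => a * u x + v x).
rewrite ip_lin //; last exact: L2_lin.
rewrite [ip Om u _]ipC [ip Om v _]ipC !ip_lin // [ip Om v u]ipC; nra.
Qed.

Lemma L2norm_sqr (u : point -> R) : L2norm Om u ^+ 2 = ip Om u u.
Proof. by rewrite sqr_sqrtr // ip_ge0. Qed.

Definition grad_L2 (v : vfield R d) := forall i j, L2 Om (fun x => v.2 x i j).

Lemma grad_ip_sum (v w : vfield R d) : grad_L2 v -> grad_L2 w ->
  grad_ip Om v w =
  \sum_(i < d) \sum_(j < d) ip Om (fun x => v.2 x i j) (fun x => w.2 x i j).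
Proof.
move=> lv lw; rewrite /grad_ip.
pose F (k : 'I_d * 'I_d) x := v.2 x k.1 k.2 * w.2 x k.1 k.2.
have iF k : intg (F k) by exact: L2_mul_integrable.
rewrite pair_bigA /=.
transitivity (\int[mu]_(x in Om) \sum_k F k x).
  by apply: eq_Rintegral => x _; rewrite pair_bigA.
rewrite -[RHS]/(\sum_k (\int[mu]_(x in Om) F k x)).
elim: (index_enum _) => [|k s ih]; last first.
  rewrite big_cons -ih -[X in X + _]mul1r -Rintegral_lin //.
    by apply: eq_Rintegral => x _; rewrite big_cons mul1r.
  rewrite (_ : _ \o _ = (fun x => \sum_(i <- s) (EFin \o F i) x)%E).
    exact: integrable_sum.
  by apply/funext => x /=; rewrite sumEFin.
by rewrite big_nil; under eq_Rintegral do rewrite big_nil; rewrite Rintegral_cst // mul0r.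
Qed.

Lemma grad_ipC (v w : vfield R d) : grad_ip Om v w = grad_ip Om w v.
Proof.
by apply: eq_Rintegral => x _; do 2!(apply: eq_bigr => ? _); rewrite mulrC.
Qed.

Lemma grad_L2_lin (a : R) (u v : vfield R d) :
  grad_L2 u -> grad_L2 v -> grad_L2 (a *: u + v).
Proof.
move=> lu lv i j; rewrite (_ : (fun _ => _) = (fun x => a * u.2 x i j + v.2 x i j)).
  exact: L2_lin.
by apply/funext => x /=; rewrite !mxE.
Qed.

Lemma grad_ip_lin (a : R) (u v w : vfield R d) :
  grad_L2 u -> grad_L2 v -> grad_L2 w ->
  grad_ip Om (a *: u + v) w = a * grad_ip Om u w + grad_ip Om v w.
Proof.
move=> lu lv lw; rewrite !grad_ip_sum //; last exact: grad_L2_lin.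
rewrite mulr_sumr -big_split /=; apply: eq_bigr => i _.
rewrite mulr_sumr -big_split /=; apply: eq_bigr => j _.
rewrite -ip_lin //; congr ip; apply/funext => x /=.
by rewrite !mxE.
Qed.

Lemma grad_ipBl (u v w : vfield R d) : grad_L2 u -> grad_L2 v -> grad_L2 w ->
  grad_ip Om (u - v) w = grad_ip Om u w - grad_ip Om v w.
Proof.
by move=> lu lv lw; rewrite addrC -scaleN1r grad_ip_lin //; ring.
Qed.

Lemma grad_ip_sqrB (u v : vfield R d) : grad_L2 u -> grad_L2 v ->
  grad_ip Om (u - v) (u - v) =
  grad_ip Om u u - 2 * grad_ip Om v u + grad_ip Om v v.
Proof.
move=> lu lv; have luv : grad_L2 (u - v).
  by rewrite addrC -scaleN1r; exact: grad_L2_lin.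
rewrite grad_ipBl // [grad_ip Om u (_ - _)]grad_ipC.
rewrite [grad_ip Om v (_ - _)]grad_ipC !grad_ipBl //.
by rewrite [grad_ip Om u v]grad_ipC; ring.
Qed.

Lemma grad_ip_ge0 (v : vfield R d) : 0 <= grad_ip Om v v.
Proof.
apply: Rintegral_ge0 => x _; do 2!(apply: sumr_ge0 => ? _).
by rewrite -expr2 sqr_ge0.
Qed.

Lemma grad_norm_sqr (v : vfield R d) : grad_norm Om v ^+ 2 = grad_ip Om v v.
Proof. by rewrite sqr_sqrtr // grad_ip_ge0. Qed.

Lemma div_L2 (v : vfield R d) : grad_L2 v -> L2 Om (div v).
Proof. by move=> lv; apply: L2_sum. Qed.

Lemma divB (u v : vfield R d) : div (u - v) = div u - div v.
Proof. by apply/funext => x; rewrite /div raddfB. Qed.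

(** A vector of zero seminorm is orthogonal to every [v]: the nonnegative quadratic in [t] given by
    $\|\nabla(tu+v)\|^2$ degenerates to an affine function, whose slope must be zero. *)
Lemma grad_norm_linl (a : R) (u v : vfield R d) : grad_L2 u -> grad_L2 v ->
  grad_norm Om u = 0 -> grad_norm Om (a *: u + v) = grad_norm Om v.
Proof.
move=> lu lv u0.
have uu0 : grad_ip Om u u = 0 by rewrite -grad_norm_sqr u0 expr0n.
have q t : 0 <= 2 * t * grad_ip Om u v + grad_ip Om v v.
  have := grad_ip_ge0 (t *: u + v); rewrite grad_ip_lin //; last exact: grad_L2_lin.
  rewrite [grad_ip Om u _]grad_ipC [grad_ip Om v _]grad_ipC !grad_ip_lin //.
  rewrite [grad_ip Om v u]grad_ipC uu0; nra.
have uv0 : grad_ip Om u v = 0.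
  apply/eqP; apply: contraT => uv0.
  (* At this [t] the affine function takes the value -1. *)
  have := q (- (1 + grad_ip Om v v) / (2 * grad_ip Om u v)).
  rewrite (_ : 2 * _ * _ = - (1 + grad_ip Om v v)); last by field.
  by lra.
congr Num.sqrt; rewrite grad_ip_lin //; last exact: grad_L2_lin.
rewrite [grad_ip Om u _]grad_ipC [grad_ip Om v (_ + _)]grad_ipC !grad_ip_lin //.
by rewrite [grad_ip Om v u]grad_ipC uu0 uv0; ring.
Qed.

End L2_pairings.

(** * Boundedness and linearity of the convection form on a linear subset [S] of [X] *)

Section convection.
Variables (R : realType) (d : nat) (Om : set 'rV[R]_d).
Hypothesis mOm : measurable Om.
Hypothesis Mfin : (Msup Om < +oo)%E.
Variable S : set (vfield R d).
Hypothesis SX : S `<=` X Om.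
Hypothesis Slin : forall (a : R) u v, S u -> S v -> S (a *: u + v).
Local Notation point := 'rV[R]_d.
Local Notation mu := (@leb R d).
Local Notation intg F := (mu.-integrable Om (EFin \o F)).
Implicit Types u v w : vfield R d.

Let S_grad_L2 v : S v -> grad_L2 Om v.
Proof. by move=> /SX Xv i j; have [[_ lg _] _] := Xv i; exact: lg. Qed.

Definition conv u v w (x : point) : R :=
  \sum_(i < d) \sum_(j < d) u.1 x ord0 j * v.2 x i j * w.1 x ord0 i.

Lemma conv_lin1 a s t v w : conv (a *: s + t) v w = (fun x => a * conv s v w x + conv t v w x).
Proof.
apply/funext => x; rewrite /conv mulr_sumr -big_split /=.
apply: eq_bigr => i _; rewrite mulr_sumr -big_split /=.
by apply: eq_bigr => j _; rewrite !mxE; ring.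
Qed.

Lemma conv_lin2 a u s t w : conv u (a *: s + t) w = (fun x => a * conv u s w x + conv u t w x).
Proof.
apply/funext => x; rewrite /conv mulr_sumr -big_split /=.
apply: eq_bigr => i _; rewrite mulr_sumr -big_split /=.
by apply: eq_bigr => j _; rewrite !mxE; ring.
Qed.

Lemma conv_lin3 a u v s t : conv u v (a *: s + t) = (fun x => a * conv u v s x + conv u v t x).
Proof.
apply/funext => x; rewrite /conv mulr_sumr -big_split /=.
apply: eq_bigr => i _; rewrite mulr_sumr -big_split /=.
by apply: eq_bigr => j _; rewrite !mxE; ring.
Qed.

Lemma measurable_conv u v w : S u -> S v -> S w -> measurable_fun Om (conv u v w).
Proof.
move=> Su Sv Sw; apply: measurable_sum => i; apply: measurable_sum => j.
have m1 t k : S t -> measurable_fun Om (fun x => t.1 x ord0 k).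
  by move=> /SX Xt; have [[[]]] := Xt k.
apply: measurable_funM; last exact: m1.
by apply: measurable_funM; [exact: m1|have [] := S_grad_L2 Sv i j].
Qed.

(** Integrability is included because an infinite integral becomes 0 as a real number, which would
    make the bound trivial, and because linearity of the integral needs it. *)
Definition conv_bounded u v w := intg (conv u v w) /\
  `|\int[mu]_(x in Om) conv u v w x| <=
    Mconst Om * grad_norm Om u * grad_norm Om v * grad_norm Om w.

(** The quotient is a member of the set whose supremum is [Msup]. Finiteness of [Msup] thus yields
    the bound and, through [fin_num_integrable], integrability. *)
Lemma conv_bounded_nz u v w : S u -> S v -> S w -> grad_norm Om u != 0 ->
  grad_norm Om v != 0 -> grad_norm Om w != 0 -> conv_bounded u v w.
Proof.
move=> Su Sv Sw u0 v0 w0.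
have c0 : 0 < grad_norm Om u * grad_norm Om v * grad_norm Om w.
  by rewrite !mulr_gt0 // lt0r ?u0 ?v0 ?w0 sqrtr_ge0.
have leM : (`|convection Om u v w| *
    ((grad_norm Om u * grad_norm Om v * grad_norm Om w)^-1)%:E <= Msup Om)%E.
  by apply: ereal_sup_ubound; exists u, v, w; split=> //; split=> //; exact: SX.
have Mfn : Msup Om \is a fin_num.
  rewrite ge0_fin_numE // (le_trans _ leM) // mule_ge0 //.
  by rewrite lee_fin invr_ge0 ltW.
(* An infinite integral would make the quotient [+oo], above the finite [Msup]. *)
have cfn : convection Om u v w \is a fin_num.
  rewrite fin_num_abs ltey; apply: contraTneq leM => ->.
  by rewrite gt0_mulye ?lte_fin ?invr_gt0 // -ltNge.
split; first by apply: fin_num_integrable => //; apply/measurable_EFinP; exact: measurable_conv.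
rewrite -[X in `|X|]/(fine (convection Om u v w)) /Mconst.
move: leM; rewrite -(fineK Mfn) -(fineK cfn) abse_EFin -EFinM lee_fin /=.
by rewrite ler_pdivrMr // !mulrA.
Qed.

(* A vector with vanishing norm is handled without the Poincare inequality:
   moving v0 by arbitrarily large multiples of it does not change the norm of
   v0, so a bounded linear functional must vanish on it. *)
Lemma bounded_linear_ext (L : vfield R d -> point -> R) (C : R) v0 :
  (forall a u v, L (a *: u + v) = (fun x => a * L u x + L v x)) ->
  S v0 -> grad_norm Om v0 != 0 ->
  (forall v, S v -> grad_norm Om v != 0 ->
    intg (L v) /\ `|\int[mu]_(x in Om) L v x| <= C * grad_norm Om v) ->
  forall v, S v ->
    intg (L v) /\ `|\int[mu]_(x in Om) L v x| <= C * grad_norm Om v.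
Proof.
move=> Llin Sv0 v00 Lnz v Sv; have [v_0|] := eqVneq (grad_norm Om v) 0; last exact: Lnz.
have nE s : grad_norm Om (s *: v + v0) = grad_norm Om v0.
  by apply: grad_norm_linl => //; exact: S_grad_L2.
have Ls s := Lnz (s *: v + v0) (Slin s Sv Sv0).
have [i0 b0] := Lnz v0 Sv0 v00.
have iv : intg (L v).
  rewrite (_ : L v = (fun x => -1 * L v0 x + L (1 *: v + v0) x)).
    by apply: integrable_lin => //; apply: (Ls 1 _).1; rewrite nE.
  by apply/funext => x; rewrite Llin; ring.
split=> //; rewrite v_0 mulr0.
have {Ls} bs s : `|s * \int[mu]_(x in Om) L v x + \int[mu]_(x in Om) L v0 x|
    <= C * grad_norm Om v0.
  by rewrite -Rintegral_lin // -Llin -(nE s); apply: (Ls s _).2; rewrite nE.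
move: bs {b0}; move: (\int[mu]_(x in Om) L v x) (\int[mu]_(x in Om) L v0 x) => I I0 bs.
suff -> : I = 0 by rewrite normr0.
apply/eqP; apply: contraT => I_0.
(* This multiple makes the left side the absolute value of [C * grad_norm Om v0 + 1], beyond the
   bound. *)
have := bs ((C * grad_norm Om v0 + 1 - I0) / I).
by rewrite divfK // subrK => /(le_trans (ler_norm _)); lra.
Qed.

(** The nonnegative [F] has zero integral, so it vanishes almost everywhere, and each squared entry
    of the Jacobian vanishes with it. *)
Lemma grad_norm0_ae v : grad_L2 Om v -> grad_norm Om v = 0 ->
  {ae mu, forall x, Om x -> v.2 x = 0}.
Proof.
move=> lv v0; pose F x := \sum_(i < d) \sum_(j < d) v.2 x i j * v.2 x i j.
have iF : intg F.
  rewrite (_ : _ \o _ = (fun x => \sum_(i < d) (\sum_(j < d)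
    (EFin \o (fun y => (v.2 y i j * v.2 y i j)%R)) x))%E).
    do 2!(apply: integrable_sum => // ? _).
    exact: L2_mul_integrable.
  by apply/funext => x /=; rewrite -sumEFin; apply: eq_bigr => i _; rewrite -sumEFin.
have F0 x : 0 <= F x.
  by do 2!(apply: sumr_ge0 => ? _); rewrite -expr2 sqr_ge0.
have /(ae_eq_integral_abs mu mOm (measurable_int mu iF)) : (\int[mu]_(x in Om) `|(EFin \o F) x| = 0)%E.
  under eq_integral => x _ do rewrite /= ger0_norm //.
  rewrite -(fineK (integrable_fin_num mOm iF)); congr EFin.
  by rewrite -[LHS]/(grad_ip Om v v) -grad_norm_sqr v0 expr0n.
apply: filterS => x /= xF Omx; have {xF} [xF] := xF Omx.
apply/matrixP => i j; rewrite mxE; apply/eqP; rewrite -sqrf_eq0 expr2.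
have /eqP := xF; rewrite psumr_eq0 => [/allP/(_ i)|k _]; last first.
  by apply: sumr_ge0 => ? _; rewrite -expr2 sqr_ge0.
rewrite mem_index_enum => /(_ isT) /=; rewrite psumr_eq0 => [/allP/(_ j)|k _].
  by rewrite mem_index_enum => /(_ isT).
by rewrite -expr2 sqr_ge0.
Qed.

(** The middle argument enters only through its gradient, so if that has norm zero the integrand is
    zero almost everywhere. Otherwise [v] itself is the reference vector of nonzero norm for
    [bounded_linear_ext], which removes the restriction first from the first argument, then from the
    third. *)
Lemma conv_boundedP u v w : S u -> S v -> S w -> conv_bounded u v w.
Proof.
move=> Su Sv Sw; have [v0|v_nz] := eqVneq (grad_norm Om v) 0.
  have mc : measurable_fun Om (EFin \o conv u v w).
    by apply/measurable_EFinP; exact: measurable_conv.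
  have c0 : (\int[mu]_(x in Om) `|(EFin \o conv u v w) x| = 0)%E.
    apply/(ae_eq_integral_abs mu mOm mc).
    apply: filterS (grad_norm0_ae (S_grad_L2 Sv) v0) => x /= xv Omx.
    congr EFin; apply: big1 => i _; apply: big1 => j _.
    by rewrite xv // mxE mulr0 mul0r.
  have ic : intg (conv u v w) by apply/integrableP; rewrite c0.
  split=> //; rewrite v0 mulr0 mul0r.
  by rewrite (le_trans (le_normr_Rintegral mOm ic)) // /Rintegral c0.
have H1 u' w' : S u' -> S w' -> grad_norm Om w' != 0 -> conv_bounded u' v w'.
  move=> Su' Sw' w_nz.
  have [|||t St t_nz|ic] := @bounded_linear_ext (fun t => conv t v w')
    (Mconst Om * grad_norm Om v * grad_norm Om w') v _ _ _ _ u' Su' => //.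
  - by move=> a s t; rewrite conv_lin1.
  - have [ic /le_trans lec] := conv_bounded_nz St Sv Sw' t_nz v_nz w_nz.
    by split=> //; apply: lec; rewrite le_eqVlt; apply/orP; left; apply/eqP; ring.
  - move=> /le_trans lec; split=> //; apply: lec.
    by rewrite le_eqVlt; apply/orP; left; apply/eqP; ring.
apply: (@bounded_linear_ext (fun t => conv u v t)
    (Mconst Om * grad_norm Om u * grad_norm Om v) v) => //.
- by move=> a s t; rewrite conv_lin3.
- by move=> t St t_nz; exact: H1.
Qed.

Lemma bstarE u v w : bstar Om u v w =
  2^-1 * \int[mu]_(x in Om) conv u v w x - 2^-1 * \int[mu]_(x in Om) conv u w v x.
Proof. by []. Qed.

Lemma bstar_le u v w : S u -> S v -> S w ->
  `|bstar Om u v w| <= Mconst Om * grad_norm Om u * grad_norm Om v * grad_norm Om w.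
Proof.
move=> Su Sv Sw; rewrite bstarE.
have [_] := conv_boundedP Su Sv Sw; have [_] := conv_boundedP Su Sw Sv.
rewrite [X in _ <= X -> _]mulrAC !ler_norml => /andP[h1 h2] /andP[h3 h4].
by apply/andP; split; lra.
Qed.

Lemma bstar_self u v : bstar Om u v v = 0.
Proof. by rewrite bstarE subrr. Qed.

Let SB u v : S u -> S v -> S (u - v).
Proof. by move=> Su Sv; rewrite addrC -scaleN1r; exact: Slin. Qed.

(** For [w = v - v'] the first term on the right vanishes by [bstar_self], which leaves the single
    trilinear term of the energy estimate. *)
Lemma bstarB u u' v v' w : S u -> S u' -> S v -> S v' -> S w ->
  bstar Om u v w - bstar Om u' v' w =
  bstar Om u (v - v') w + bstar Om (u - u') v' w.
Proof.
move=> Su Su' Sv Sv' Sw.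
have I a b c (Sa : S a) (Sb : S b) (Sc : S c) := (conv_boundedP Sa Sb Sc).1.
have BE (s t : vfield R d) : s - t = -1 *: t + s by rewrite scaleN1r addrC.
rewrite !BE !bstarE.
rewrite !(conv_lin1, conv_lin2, conv_lin3) !Rintegral_lin //; try exact: I.
ring.
Qed.

End convection.

(** * Linear combinations in finite-dimensional subspaces, and the sign of $\mathcal{M}$ *)

Lemma findim_subspace_lin (R : realType) (V : lmodType R) (S : set V) (a : R) u v :
  findim_subspace S -> S u -> S v -> S (a *: u + v).
Proof.
move=> [n [b ->]] [c _ <-] [c' _ <-]; exists (fun i => a * c i + c' i) => //.
rewrite scaler_sumr -big_split /=; apply: eq_bigr => i _.
by rewrite scalerDl scalerA.
Qed.

Lemma findim_subspaceB (R : realType) (V : lmodType R) (S : set V) u v :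
  findim_subspace S -> S u -> S v -> S (u - v).
Proof. by move=> hS Su Sv; rewrite addrC -scaleN1r; exact: findim_subspace_lin. Qed.

Lemma Mconst_ge0 (R : realType) (d : nat) (Om : set 'rV[R]_d) : 0 <= Mconst Om.
Proof.
rewrite /Mconst /Msup; set A := (X in ereal_sup X).
(* Without nonzero fields the supremum is [-oo], which [fine] sends to 0. *)
have [->|/set0P[m Am]] := eqVneq A set0; first by rewrite ereal_sup0.
rewrite fine_ge0 // (@le_trans _ _ m) //; last exact: ereal_sup_ubound.
case: Am => u [v [w [_ _ _ ->]]]; rewrite mule_ge0 //.
by rewrite lee_fin invr_ge0 !mulr_ge0 // sqrtr_ge0.
Qed.

(** * The dual norm of the forcing *)

Section dual.
Variables (R : realType) (d : nat) (Om : set 'rV[R]_d) (f : vfield R d -> R).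
Hypothesis hf : Xdual Om f.

Let dual_quotients := [set `|f v| / grad_norm Om v | v in Xnz Om].

Let ubound_dual_quotients : has_ubound dual_quotients.
Proof.
have [_ [C fC]] := hf; exists C => _ [v [Xv v0] <-].
by rewrite ler_pdivrMr ?fC // lt0r v0 sqrtr_ge0.
Qed.

Lemma dual_norm_ge0 : 0 <= dual_norm Om f.
Proof.
rewrite /dual_norm -/dual_quotients.
(* The real supremum of the empty set is 0. *)
have [->|/set0P[m Am]] := eqVneq dual_quotients set0; first by rewrite sup0.
rewrite (@le_trans _ _ m) //; last exact: ub_le_sup.
by case: Am => v _ <-; rewrite divr_ge0 // sqrtr_ge0.
Qed.

Lemma dual_norm_le v : X Om v -> `|f v| <= dual_norm Om f * grad_norm Om v.
Proof.
(* Fields of zero gradient norm lie outside the supremum; there the continuity of [f] gives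
   [f v = 0]. *)
move=> Xv; have [v0|v0] := eqVneq (grad_norm Om v) 0.
  by have [_ [C fC]] := hf; have := fC v Xv; rewrite v0 !mulr0.
rewrite -ler_pdivrMr; last by rewrite lt0r v0 sqrtr_ge0.
by apply: ub_le_sup => //; exists v.
Qed.

End dual.

(** * Scalar inequalities behind the estimates *)

(* k, l, c stand for the gradient products (W, W), (w, W), (w, w), and D, s, zz
   for the L2 products (div W, div W), (z, div W), (z, z). *)
Lemma apriori_real (R : realType) (nu rho alpha k l c D s zz fW F : R) :
  0 < nu -> 0 < rho -> 0 < alpha -> 0 <= k -> 0 <= c -> 0 <= zz -> 0 <= F ->
  rho^-1 * (k - l) + nu * k + rho / alpha * D - s = fW ->
  0 <= k - 2 * l + c ->
  0 <= (2 * rho / alpha) ^+ 2 * D - 2 * (2 * rho / alpha) * s + zz ->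
  `|fW| <= F * Num.sqrt k ->
  Num.sqrt k <= Num.sqrt (c + alpha * zz) + Num.sqrt (rho / nu) * F.
Proof.
move=> nu0 rho0 al0 k0 c0 z0 F0 eqW sqd young fle.
(* The weight in Young's inequality is chosen so that the viscous term absorbs [nu * k]
   completely. *)
have yF : fW <= nu * k + F ^+ 2 / (4 * nu).
  have -> : nu * k + F ^+ 2 / (4 * nu) =
      F * Num.sqrt k + nu * (Num.sqrt k - F / (2 * nu)) ^+ 2.
    by rewrite -{1}(sqr_sqrtr k0); field; rewrite gt_eqF.
  rewrite (le_trans (le_trans (ler_norm _) fle)) // lerDl.
  by rewrite mulr_ge0 ?sqr_ge0 // ltW.
have rn0 : 0 <= rho / nu by rewrite divr_ge0 // ltW.
(* Since [2 * l <= k + c], half of [k] survives in [k - l], so the bound [h3] on [k - l] gets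
   doubled. *)
have kle : k <= c + alpha * zz + rho / nu * F ^+ 2.
  (* The hypothesis [young] multiplied by $\alpha/(4\rho)$. *)
  have h1 : rho / alpha * D - s >= - (alpha / (4 * rho) * zz).
    rewrite -subr_ge0 (_ : _ - _ = alpha / (4 * rho) *
      ((2 * rho / alpha) ^+ 2 * D - 2 * (2 * rho / alpha) * s + zz)).
      by rewrite mulr_ge0 // divr_ge0 // ?mulr_ge0 // ltW.
    by field; rewrite !gt_eqF.
  have h2 : rho^-1 * (k - l) <= alpha / (4 * rho) * zz + F ^+ 2 / (4 * nu) by lra.
  have h3 : k - l <= alpha / 4 * zz + rho / nu * F ^+ 2 / 4.
    have -> : k - l = rho * (rho^-1 * (k - l)) by field; rewrite gt_eqF.
    have -> : alpha / 4 * zz + rho / nu * F ^+ 2 / 4 =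
        rho * (alpha / (4 * rho) * zz + F ^+ 2 / (4 * nu)) by field; rewrite !gt_eqF.
    by rewrite ler_pM2l.
  have h4 : 0 <= alpha * zz by rewrite mulr_ge0 // ltW.
  have h5 : 0 <= rho / nu * F ^+ 2 by rewrite mulr_ge0 // sqr_ge0.
  lra.
have n0 : 0 <= c + alpha * zz by rewrite addr_ge0 // mulr_ge0 // ltW.
(* Squaring reduces the claim to [kle], as the cross term on the right is nonnegative. *)
rewrite -ler_sqr ?nnegrE ?sqrtr_ge0 ?addr_ge0 ?mulr_ge0 ?sqrtr_ge0 //.
rewrite sqr_sqrtr // sqrrD sqr_sqrtr // exprMn sqr_sqrtr //.
have : 0 <= Num.sqrt (c + alpha * zz) * (Num.sqrt (rho / nu) * F).
  by rewrite !mulr_ge0 ?sqrtr_ge0.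
by rewrite mulr2n; lra.
Qed.

(* For the differences E, e of velocities and P', p' of pressures: a, g, c stand
   for the gradient products (E, E), (e, E), (e, e), b for b*(e, W, E), and D, s,
   q1, q2, h, t for the L2 products (div E, div E), (p', div E), (p', p'),
   (P', P'), (p', P'), (div E, P'). *)
Lemma energy_real (R : realType) (nu rho alpha a g c b D s q1 q2 h t : R) :
  0 < nu -> 0 < rho -> 0 < alpha -> 0 <= a -> 0 <= D ->
  rho^-1 * (a - g) + nu * a + b + rho / alpha * D - s = 0 ->
  alpha * (q2 - h) + rho * t = 0 ->
  0 <= a - 2 * g + c ->
  0 <= (rho / alpha) ^+ 2 * D + 2 * (rho / alpha) * (t - s) + (q2 - 2 * h + q1) ->
  a + alpha * q2 <= c + alpha * q1 + 2 * rho * `|b|.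
Proof.
move=> nu0 rho0 al0 a0 D0 eq1 eq2 sqd young.
have e1 : a - g = - (rho * nu * a) - rho * b - rho ^+ 2 / alpha * D + rho * s.
  have -> : b = - (rho^-1 * (a - g) + nu * a + rho / alpha * D - s) by lra.
  by field; rewrite !gt_eqF.
have y : 0 <= rho ^+ 2 / alpha * D + 2 * rho * (t - s) + alpha * (q2 - 2 * h + q1).
  have -> : rho ^+ 2 / alpha * D + 2 * rho * (t - s) + alpha * (q2 - 2 * h + q1) =
    alpha * ((rho / alpha) ^+ 2 * D + 2 * (rho / alpha) * (t - s) + (q2 - 2 * h + q1)).
    by field; rewrite gt_eqF.
  by rewrite mulr_ge0 // ltW.
have bb : - (rho * b) <= rho * `|b|.
  by rewrite -mulrN ler_pM2l // -normrN ler_norm.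
have p1 : 0 <= rho * nu * a by rewrite !mulr_ge0 // ltW.
have p2 : 0 <= rho ^+ 2 / alpha * D by rewrite !mulr_ge0 ?invr_ge0 ?sqr_ge0 // ltW.
(* By polarisation $2(a-g)$ and $2(q_2-h)$ are $a-c$ and $q_2-q_1$ plus squares. The velocity square
   is dropped; the pressure square and the coupling $2\rho(t-s)$ are controlled by [y], at the cost
   of one of the two available copies of $\frac{\rho^2}{\alpha}D$. *)
lra.
Qed.

(** Here [K] is [Kconst], [B] is $\rho\mathcal{M}\|\nabla W\|$, and [B'] is its a priori bound in
    terms of the data. *)
Lemma CL_real (R : realType) (K B B' N n : R) : 0 < K <= 1 / 4 ->
  0 <= B <= B' -> 0 <= N -> 0 <= n -> N ^+ 2 <= n ^+ 2 + 2 * B * n * N ->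
  N <= Num.sqrt 2 * Num.max (Num.sqrt (2 / K)) (1 / Num.sqrt K * (1 + B')) * n.
Proof.
move=> /andP[K0 K4] /andP[B0 BB] N0 n0 Nn.
have s2 : 1 <= Num.sqrt 2 :> R by rewrite -[leLHS]sqrtr1 ler_sqrt; lra.
have sK : 2 <= 1 / Num.sqrt K.
  rewrite ler_pdivlMr ?sqrtr_gt0 // mulrC -ler_pdivlMr //.
  rewrite -[leRHS]ger0_norm; last by lra.
  by rewrite -sqrtr_sqr ler_sqrt ?sqr_ge0 //; lra.
have N1 : N <= (1 + 2 * B) * n.
  (* Otherwise [N] and [N - 2 * B * n] both exceed [n], and their product exceeds [n ^+ 2]. *)
  rewrite leNgt; apply/negP => lt1.
  have : 0 <= B * n by rewrite mulr_ge0.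
  nra.
apply: (le_trans N1); rewrite ler_wpM2r //.
apply: (@le_trans _ _ (1 * (2 * (1 + B')))); first lra.
apply: ler_pM => //; first lra.
by rewrite le_max; apply/orP; right; rewrite ler_wpM2r //; lra.
Qed.

Theorem lemma3p2 (R : realType) (d : nat) (hd : d = 2%N \/ d = 3%N)
  (Om : set 'rV[R]_d)
  (domOm : bounded_domain Om) (lipOm : lipschitz_boundary Om)
  (Mfin : (Msup Om < +oo)%E)
  (f : vfield R d -> R) (hf : Xdual Om f)
  (Xh : set (vfield R d)) (hXh : findim_subspace Xh) (XhX : Xh `<=` X Om)
  (Qh : set ('rV[R]_d -> R)) (hQh : findim_subspace Qh) (QhQ : Qh `<=` L20 Om)
  (nu rho alpha : R) (nu0 : 0 < nu) (rho0 : 0 < rho) (alpha0 : 0 < alpha)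
  (hra : 3 * d%:R / 2 * rho ^+ 2 < alpha)
  (G : vfield R d * ('rV[R]_d -> R) -> vfield R d * ('rV[R]_d -> R))
  (hG : is_G Om Xh Qh nu rho alpha f G)
  (u w : vfield R d) (p z : 'rV[R]_d -> R)
  (hup : Hh Xh Qh (u, p)) (hwz : Hh Xh Qh (w, z)) :
  Hnorm Om alpha (G (u, p) - G (w, z))
    <= CL Om nu rho alpha f (w, z) * Hnorm Om alpha ((u, p) - (w, z)).
Proof.
have mOm : measurable Om by case: domOm => _ oOm _ _; exact: open_measurable_rV.
have [HU] := hG _ hup; have [HW] := hG _ hwz.
move: HU HW; case: (G (u, p)) => U P; case: (G (w, z)) => W Z.
move=> [/= XU QP] [/= XW QZ] eqW eqU.
case: hup hwz => /= Xu Qp [/= Xw Qz].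
pose E := U - W; pose e := u - w; pose P' := P - Z; pose p' := p - z.
have XE : Xh E by exact: findim_subspaceB.
have Xe : Xh e by exact: findim_subspaceB.
have QP' : Qh P' by exact: findim_subspaceB.
have Qp' : Qh p' by exact: findim_subspaceB.
have gL v : Xh v -> grad_L2 Om v.
  by move=> /XhX Xv i j; have [[_ lg _] _] := Xv i; exact: lg.
have qL q : Qh q -> L2 Om q by move=> /QhQ[].
have dL v : Xh v -> L2 Om (div v) by move=> /gL; exact: div_L2.
have Slin (a : R) s t : Xh s -> Xh t -> Xh (a *: s + t) by exact: findim_subspace_lin.
have sqd (s t : vfield R d) : Xh s -> Xh t ->
    0 <= grad_ip Om s s - 2 * grad_ip Om t s + grad_ip Om t t.
  by move=> Xs Xt; rewrite -grad_ip_sqrB ?grad_ip_ge0 //; exact: gL.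
have mW : grad_norm Om W <= Hnorm Om alpha (w, z) + Num.sqrt (rho / nu) * dual_norm Om f.
  (* Only the velocity equation is used; [z] merely fills the slot of the pressure test function. *)
  have [eq1 _] := eqW W z XW Qz.
  rewrite bstar_self addr0 grad_ipBl // in eq1; try exact: gL.
  rewrite /Hnorm /= grad_norm_sqr // L2norm_sqr //.
  have fle := dual_norm_le hf (XhX _ XW).
  apply: (apriori_real nu0 rho0 alpha0 _ _ _ _ eq1) => //.
  - exact: grad_ip_ge0.
  - exact: grad_ip_ge0.
  - exact: ip_ge0.
  - exact: dual_norm_ge0.
  - exact: sqd.
  - have := ip_young mOm (- (2 * rho / alpha)) (dL _ XW) (qL _ Qz).
    by rewrite sqrrN [ip Om (div W) z]ipC; lra.
have [eqU1 eqU2] := eqU E P' XE QP'; have [eqW1 eqW2] := eqW E P' XE QP'.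
set b := bstar Om e W E.
have ble : `|b| <= Mconst Om * grad_norm Om e * grad_norm Om W * grad_norm Om E.
  by apply: (@bstar_le _ _ _ mOm Mfin Xh).
have energy : grad_ip Om E E + alpha * ip Om P' P' <=
    grad_ip Om e e + alpha * ip Om p' p' + 2 * rho * `|b|.
  have gE (s t : vfield R d) : Xh s -> Xh t ->
      grad_ip Om (s - t) E = grad_ip Om s E - grad_ip Om t E.
    by move=> Xs Xt; apply: grad_ipBl => //; exact: gL.
  have bE := @bstarB _ _ _ mOm Mfin Xh XhX Slin u w U W E Xu Xw XU XW XE.
  rewrite bstar_self add0r -/b in bE.
  have dE v : L2 Om v -> ip Om (div E) v = ip Om (div U) v - ip Om (div W) v.
    by move=> Lv; rewrite divB ipBl //; exact: dL.
  have pE v : L2 Om v -> ip Om p' v = ip Om p v - ip Om z v.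
    by move=> Lv; rewrite ipBl //; exact: qL.
  have PE v : L2 Om v -> ip Om P' v = ip Om P v - ip Om Z v.
    by move=> Lv; rewrite ipBl //; exact: qL.
  apply: (@energy_real _ nu rho alpha _ (grad_ip Om e E) _ b (ip Om (div E) (div E))
    (ip Om p' (div E)) _ _ (ip Om p' P') (ip Om (div E) P')) => //.
  - exact: grad_ip_ge0.
  - exact: ip_ge0.
  - rewrite -bE pE ?dE; try exact: dL.
    rewrite (gE U u) // in eqU1; rewrite (gE W w) // in eqW1.
    rewrite [grad_ip Om E E](gE U W) // [grad_ip Om e E](gE u w) //.
    (* Zero is written as [f E - f E], and each copy is replaced by the left side of one velocity
       equation. *)
    by rewrite -(subrr (f E)) -{1}eqU1 -eqW1; ring.
  - rewrite PE ?dE ?pE; try exact: qL.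
    rewrite !ipBl in eqU2 eqW2; try exact: mOm; try exact: qL.
    by rewrite -[RHS](subrr 0) -{1}eqU2 -eqW2; ring.
  - exact: sqd.
  (* Expansion of $\|\frac{\rho}{\alpha}\nabla\cdot E+(P'-p')\|^2$, whose cross terms are the
     divergence couplings of the two equations. *)
  - have := ip_young mOm (rho / alpha) (dL _ XE) (L2B mOm (qL _ QP') (qL _ Qp')).
    rewrite ip_sqrB //; try exact: qL.
    rewrite [ip Om (div E) (P' - p')]ipC (@ipBl _ _ _ mOm P' p'); try (exact: qL || exact: dL).
    by rewrite [ip Om P' (div E)]ipC; lra.
have nE v q : Hnorm Om alpha (v, q) ^+ 2 = grad_ip Om v v + alpha * ip Om q q.
  rewrite sqr_sqrtr /= ?grad_norm_sqr ?L2norm_sqr //.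
  by rewrite addr_ge0 ?grad_ip_ge0 // mulr_ge0 ?ip_ge0 // ltW.
have nle v q : grad_norm Om v <= Hnorm Om alpha (v, q).
  rewrite -ler_sqr ?nnegrE ?sqrtr_ge0 // nE grad_norm_sqr // lerDl.
  by rewrite mulr_ge0 ?ip_ge0 // ltW.
(* Subtraction of pairs is componentwise by conversion. *)
change (Hnorm Om alpha (E, P') <= CL Om nu rho alpha f (w, z) * Hnorm Om alpha (e, p')).
have M0 := Mconst_ge0 Om.
apply: (@CL_real _ _ (rho * Mconst Om * grad_norm Om W)).
(* [hra] says exactly that the second entry of [Kconst] is positive. *)
- rewrite lt_min ge_min lexx andbT; apply/andP; split; first lra.
  rewrite subr_gt0 ltr_pdivrMr; last by rewrite mulr_gt0.
  lra.
(* The inequality between the two constants is [mW] multiplied by $\rho\mathcal{M}$. *)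
- by rewrite !mulr_ge0 ?sqrtr_ge0 ?ler_wpM2l ?mulr_ge0 // ltW.
- exact: sqrtr_ge0.
- exact: sqrtr_ge0.
rewrite !nE (le_trans energy) // lerD2l.
(* Regrouped to match [ble], with the gradient norms of [e] and [E] enlarged to product norms by
   [nle]. *)
have -> : 2 * (rho * Mconst Om * grad_norm Om W) * Hnorm Om alpha (e, p') * Hnorm Om alpha (E, P') =
  2 * rho * (Mconst Om * Hnorm Om alpha (e, p') * grad_norm Om W * Hnorm Om alpha (E, P')) by ring.
rewrite ler_pM2l ?mulr_gt0 // (le_trans ble) //.
by rewrite !(ler_pM, mulr_ge0, sqrtr_ge0).
Qed.
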